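(* If there exist a polynomial $P$ and an algorithm which, given an integer $n\ge0$ in unary, outputs in time $P(n)$ a join/union expression over the sets $([n],[n])$ whose semantics is exactly the set $\mathfrak S_n$ of permutations of $[n]$ (viewed as functions $[n]\to[n]$), then $\mathsf P=\#\mathsf P$.
   Context: Join/union expressions over finite sets $(S,T)$ are generated by the grammar $E ::= \emptyset \mid T^{\emptyset} \mid (s\mapsto t) \mid E\uplus E \mid E\Join E$ with $(s,t)\in S\times T$; $dom(E)$ is the set of $s$ such that some leaf of $E$ is $(s\mapsto t)$. The semantics $[E]$ is either FAIL or a subset of $T^{dom(E)}$: $[\emptyset]=\emptyset$; $[T^\emptyset]=T^\emptyset$ (containing only the empty function); $[s\mapsto t]=\{(s\mapsto t)\}$; $[E_1\uplus E_2]$ is FAIL if either $[E_i]$ is FAIL, else $[E_1]$ if $[E_2]=\emptyset$, else $[E_2]$ if $[E_1]=\emptyset$, else FAIL if $dom(E_1)\neq dom(E_2)$ or $[E_1]\cap[E_2]\ne\emptyset$, else $[E_1]\cup[E_2]$; $[E_1\Join E_2]$ is FAIL if either $[E_i]$ is FAIL or $dom(E_1)\cap dom(E_2)\neq\emptyset$, else $\{f_1\Join f_2: f_i\in[E_i]\}$, where $f_1\Join f_2$ is the function on the disjoint union of the domains agreeing with $f_1$ and $f_2$. $[n]=\{1,\dots,n\}$. *)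

(* Defs.v *)
From mathcomp Require Import all_boot all_fingroup all_algebra.

Set Implicit Arguments.
Unset Strict Implicit.
Unset Printing Implicit Defensive.

(** * Join/union expressions *)

Inductive expr (S T : Type) : Type :=
| EEmpty
| EUnit (* the leaf T^∅ *)
| ELeaf of S & T
| EUnion of expr S T & expr S T
| EJoin of expr S T & expr S T.

Arguments EEmpty {S T}.
Arguments EUnit {S T}.

(** A function from a subset D of S to T is represented by the partial function
    {ffun S -> option T} whose value is None exactly outside D.  Since
    [E1 ⊎ E2] is [E1] when [E2] = ∅ even if dom(E1) <> dom(E2), the elements of
    a semantics do not all have the syntactic domain of the expression. *)
Section Semantics.
Variables S T : finType.
Implicit Types (E : expr S T) (f : {ffun S -> option T}).

Fixpoint dom E : {set S} :=
  match E with
  | EEmpty | EUnit => set0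
  | ELeaf s _ => [set s]
  | EUnion E1 E2 | EJoin E1 E2 => dom E1 :|: dom E2
  end.

Definition pfun_empty : {ffun S -> option T} := [ffun=> None].

Definition pfun_single (s : S) (t : T) : {ffun S -> option T} :=
  [ffun x => if x == s then Some t else None].

(** Only used when the domains of f1 and f2 are disjoint. *)
Definition pfun_join f1 f2 : {ffun S -> option T} :=
  [ffun x => if f1 x is Some t then Some t else f2 x].

(** None stands for FAIL. *)
Fixpoint sem E : option {set {ffun S -> option T}} :=
  match E with
  | EEmpty => Some set0
  | EUnit => Some [set pfun_empty]
  | ELeaf s t => Some [set pfun_single s t]
  | EUnion E1 E2 =>
      match sem E1, sem E2 with
      | Some A1, Some A2 =>
          if A2 == set0 then Some A1
          else if A1 == set0 then Some A2
          else if (dom E1 != dom E2) || (A1 :&: A2 != set0) then None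
          else Some (A1 :|: A2)
      | _, _ => None
      end
  | EJoin E1 E2 =>
      match sem E1, sem E2 with
      | Some A1, Some A2 =>
          if dom E1 :&: dom E2 != set0 then None
          else Some [set pfun_join f1 f2 | f1 in A1, f2 in A2]
      | _, _ => None
      end
  end.

End Semantics.

(** The set [n] = {1, ..., n} is 'I_n, the ordinal i standing for i.+1. *)
Definition permutations_set (n : nat) : {set {ffun 'I_n -> option 'I_n}} :=
  [set [ffun i => Some (p i)] | p : {perm 'I_n}].

Definition encode_ord (n : nat) (i : 'I_n) : seq bool :=
  rcons (nseq i.+1 true) false.

(** Prefix (Polish) notation, with prefix-free codes for the five symbols. *)
Fixpoint encode_expr (n : nat) (E : expr 'I_n 'I_n) : seq bool :=
  match E with
  | EEmpty => [:: false; false; false]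
  | EUnit => [:: false; false; true]
  | ELeaf s t => [:: false; true] ++ encode_ord s ++ encode_ord t
  | EUnion E1 E2 => [:: true; false] ++ encode_expr E1 ++ encode_expr E2
  | EJoin E1 E2 => [:: true; true] ++ encode_expr E1 ++ encode_expr E2
  end.

(** * Deterministic multi-tape Turing machines *)

Inductive move := MoveLeft | MoveStay | MoveRight.

(** The tape alphabet has a blank None, the two bits Some (inl b), and
    arbitrary further symbols Some (inr a). *)
Definition symbol (A : finType) : finType := option (bool + A)%type.

(** k.+1 tapes; the input is on tape ord0, the output on tape ord_max. *)
Record machine := Machine {
  tm_tapes : nat;
  tm_extra : finType;
  tm_state : finType;
  tm_start : tm_state;
  tm_halt : pred tm_state;
  tm_trans : tm_state -> {ffun 'I_tm_tapes.+1 -> symbol tm_extra} ->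
    tm_state * ('I_tm_tapes.+1 -> symbol tm_extra * move)
}.

(** A two-way infinite tape: the symbols left of the head, nearest first, the
    scanned symbol, and the symbols right of the head; cells not listed are
    blank. *)
Record tape (G : Type) := Tape {
  tape_left : seq G;
  tape_head : G;
  tape_right : seq G
}.

Section Tapes.
Variable A : finType.
Implicit Type t : tape (symbol A).

Definition tape_of_seq (s : seq (symbol A)) : tape (symbol A) :=
  Tape [::] (head None s) (behead s).

Definition tape_write (a : symbol A) t : tape (symbol A) :=
  Tape (tape_left t) a (tape_right t).

Definition tape_move (d : move) t : tape (symbol A) :=
  let: Tape l h r := t in
  match d with
  | MoveLeft => Tape (behead l) (head None l) (h :: r)
  | MoveStay => t
  | MoveRight => Tape (h :: l) (head None r) (behead r)
  end.

Fixpoint leading_bits (s : seq (symbol A)) : seq bool :=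
  if s is Some (inl b) :: s' then b :: leading_bits s' else [::].

(** The bits from the head rightwards, up to the first cell that is no bit. *)
Definition tape_output t : seq bool :=
  leading_bits (tape_head t :: tape_right t).

End Tapes.

Section Runs.
Variable M : machine.

Definition config : Type :=
  (tm_state M * ('I_(tm_tapes M).+1 -> tape (symbol (tm_extra M))))%type.

Definition init_config (x : seq bool) : config :=
  (tm_start M,
   fun i => tape_of_seq (if i == ord0 then [seq Some (inl b) | b <- x]
                         else [::])).

Definition halted (c : config) : bool := tm_halt c.1.

Definition step (c : config) : config :=
  if halted c then c else
  let: (q, act) := tm_trans c.1 [ffun i => tape_head (c.2 i)] in
  (q, fun i => tape_move (act i).2 (tape_write (act i).1 (c.2 i))).

(** On input x, the machine halts after at most t steps with output y (a
    halted configuration is a fixed point of step). *)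
Definition outputs_within (x : seq bool) (t : nat) (y : seq bool) : Prop :=
  let c := iter t step (init_config x) in
  halted c /\ tape_output (c.2 ord_max) = y.

End Runs.

(** * Complexity classes of counting functions *)

Definition polytime (g : seq bool -> seq bool) : Prop :=
  exists (M : machine) (P : {poly nat}),
    forall x, outputs_within M x P.[size x]%R (g x).

(** Binary, most significant bit first, leading zeros allowed. *)
Definition binary_value (w : seq bool) : nat :=
  foldl (fun (v : nat) (b : bool) => v.*2 + b) 0 w.

Definition encode_pair (x y : seq bool) : seq bool :=
  flatten [seq [:: b; b] | b <- x] ++ [:: false; true] ++ y.

(** The class P of "P = #P": number-valued functions computable in
    polynomial time, often written FP. *)
Definition in_FP (f : seq bool -> nat) : Prop :=
  exists2 g : seq bool -> seq bool,
    polytime g & forall x, binary_value (g x) = f x.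

Definition in_sharpP (f : seq bool -> nat) : Prop :=
  exists (p : {poly nat}) (V : seq bool -> bool),
    polytime (fun w => [:: V w]) /\
    forall x, f x = #|[set y : (p.[size x]%R).-tuple bool | V (encode_pair x y)]|.

Definition P_eq_sharpP : Prop :=
  forall f : seq bool -> nat, in_FP f <-> in_sharpP f.

(* Main.v *)
(** The hypothesis fails unconditionally: no family of polynomial-size
    join/union expressions has semantics 𝔖_n.  (This is a formula version of
    the Jerrum-Snir lower bound for monotone computations of the permanent.)

    If the semantics of an expression consists of bijections between two fixed
    k-element sets, then both operands of a contributing join have the same
    property, for k1 + k2 = k, so the join produces at most k1! k2! functions.
    Descending from the root of an expression for 𝔖_n, n = 3m, always into the
    larger operand of a join, one meets a k with m < k <= 2m; the permutations
    obtained through such a node number at most k! (n - k)! <= n! / 2^m.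
    Hence the expression has at least 2^m leaves, whereas a machine running in
    time P(n) outputs at most n + 1 + P(n) symbols. *)

Require Import Defs.
From mathcomp Require Import all_boot all_fingroup all_algebra.
From mathcomp Require Import zify.

Set Implicit Arguments.
Unset Strict Implicit.
Unset Printing Implicit Defensive.

(** * Growth of factorials and polynomials *)

Lemma leq_fact_mul (a b : nat) : a`! * b`! <= (a + b)`!.
Proof.
have := @bin_fact (a + b) a (leq_addr _ _).
rewrite addKn => <-; apply: leq_pmull.
by rewrite bin_gt0 leq_addr.
Qed.

(** Raising both [a] and [b] by one gains a factor 2, because [2(a+1)(b+1) <= (a+b+2)(a+b+1)]. *)
Lemma leq_exp2_fact_mul (m a b : nat) :
  m <= a -> m <= b -> 2 ^ m * (a`! * b`!) <= (a + b)`!.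
Proof.
elim: m a b => [|m IHm] a b; first by rewrite mul1n leq_fact_mul.
case: a b => [|a] [|b] // lema lemb.
have IH := IHm a b lema lemb.
rewrite addSn addnS !factS expnS.
have -> : 2 * 2 ^ m * (a.+1 * a`! * (b.+1 * b`!)) =
  (2 * a.+1 * b.+1) * (2 ^ m * (a`! * b`!)) by nia.
by rewrite [leqRHS]mulnA leq_mul //; nia.
Qed.

Lemma poly_leq_monomial (P : {poly nat}) :
  exists c d : nat, forall n : nat, P.[n]%R <= c * n.+1 ^ d.
Proof.
elim/poly_ind: P => [|P a [c [d IH]]].
  by exists 0, 0 => n; rewrite horner0.
exists (c + a), d.+1 => n; rewrite hornerMXaddC !natrE expnS.
have h1 : 0 < n.+1 ^ d by rewrite expn_gt0.
have h2 := IH n.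
by rewrite mulnDl leq_add //; nia.
Qed.

Lemma exp2_not_leq_poly (P : {poly nat}) :
  ~ forall m : nat, 2 ^ m <= P.[m]%R.
Proof.
have [c [d leP]] := poly_leq_monomial P => le2P.
(* The bound will be tested at [m = 2 ^ j]. Taking [j = 2i] gives [2 ^ j >= (i+1)^2], which beats
   [c + d + j * d], a quadratic in [c] and [d]. *)
pose i := c + d.*2; pose j := i.*2.
have lt_j : c + d + j * d < 2 ^ j.
  have lti := ltn_expl i (isT : 1 < 2).
  have -> : 2 ^ j = 2 ^ i * 2 ^ i by rewrite -expnD addnn.
  by apply: (@leq_trans (i.+1 * i.+1)); [rewrite /j /i; nia | exact: leq_mul].
have := leq_trans (le2P (2 ^ j)) (leP (2 ^ j)).
rewrite leqNgt => /negP; apply.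
(* Uses [c <= 2 ^ c] and [2 ^ j + 1 <= 2 ^ (j+1)]. *)
apply: (@leq_ltn_trans (2 ^ (c + d + j * d))); last by rewrite ltn_exp2l.
rewrite -addnA -mulSn expnD expnM leq_mul //.
  exact/ltnW/ltn_expl.
have [->|d_gt0] := posnP d; first by rewrite !expn0.
by rewrite leq_exp2r // expnS; have := expn_gt0 2 j; lia.
Qed.

(** * Partial injections *)

Section PartialInjections.
Variables S T : finType.
Implicit Types (f g : {ffun S -> option T}) (D : {set S}) (J : {set option T}).

Definition supp f : {set S} := [set x | f x != None].

(** The image [J] is fixed along with the domain: this is what brings the count down to a factorial
    of [#|D|]. *)
Definition pinj D J f : Prop :=
  [/\ supp f = D, f @: D = J & {in D &, injective f}].

(** Enumerating [D] turns the members of [A] into distinct injections from [#|D|] points into [J],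
    and [#|J| = #|D|] once [A] is inhabited. *)
Lemma card_pinj_leq D J (A : {set {ffun S -> option T}}) :
  {in A, forall f, pinj D J f} -> #|A| <= #|D|`!.
Proof.
move=> pA; have [->|[f0 Af0]] := set_0Vmem A; first by rewrite cards0.
have cJ : #|J| = #|D| by have [_ <- inj] := pA _ Af0; rewrite card_in_imset.
pose F f : {ffun 'I_#|D| -> option T} := [ffun i => f (enum_val i)].
have injF : {in A &, injective F}.
  move=> f g Af Ag /ffunP eqF; apply/ffunP => x.
  have [sf _ _] := pA _ Af; have [sg _ _] := pA _ Ag.
  have [Dx|nDx] := boolP (x \in D).
    by have := eqF (enum_rank_in Dx x); rewrite !ffunE enum_rankK_in.
  have := nDx; rewrite -{1}sf inE negbK => /eqP ->.
  by move: nDx; rewrite -{1}sg inE negbK => /eqP ->.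
have -> : #|D|`! = #|J| ^_ #|'I_#|D| | by rewrite card_ord cJ ffactnn.
rewrite -(card_in_imset injF) -card_inj_ffuns_on; apply/subset_leq_card.
apply/subsetP => _ /imsetP[f Af ->]; have [_ fJ injf] := pA _ Af.
rewrite inE; apply/andP; split.
  by apply/ffun_onP => i; rewrite ffunE -fJ imset_f ?enum_valP.
apply/injectiveP => i i'; rewrite !ffunE => /injf.
by rewrite !enum_valP => /(_ isT isT) /enum_val_inj.
Qed.

Lemma supp_join f g : supp (pfun_join f g) = supp f :|: supp g.
Proof. by apply/setP => x; rewrite !inE ffunE; case: (f x). Qed.

Lemma pfun_joinC f g :
  [disjoint supp f & supp g] -> pfun_join f g = pfun_join g f.
Proof.
move=> /pred0P dis; apply/ffunP => x; rewrite !ffunE.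
by have := dis x; rewrite !inE /=; case: (f x); case: (g x).
Qed.

(** For a fixed [g], every [f] that joins with it to a bijection from [D] to [J] has the same domain
    and image. This passes [pinj] down to the operands of a join. *)
Lemma pinj_joinl D J f g :
  [disjoint supp f & supp g] -> pinj D J (pfun_join f g) ->
  pinj (D :\: supp g) (J :\: g @: supp g) f.
Proof.
move=> dis []; rewrite supp_join => sD sJ inj.
have dfg x : x \in supp f -> x \notin supp g.
  by move=> fx; rewrite (disjointFr dis).
have sDf : D :\: supp g = supp f.
  apply/setP => x; rewrite -sD !in_setD in_setU.
  by case: (boolP (x \in supp f)) => [/dfg ->|]; last case: (x \in supp g).
have jf x : x \in supp f -> pfun_join f g x = f x.
  by rewrite inE ffunE; case: (f x).
have jg x : x \in supp g -> pfun_join f g x = g x.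
  by rewrite pfun_joinC // inE ffunE; case: (g x).
have fD x : x \in supp f -> x \in D by rewrite -sD in_setU => ->.
have gD x : x \in supp g -> x \in D by rewrite -sD in_setU orbC => ->.
rewrite sDf; split=> // [|x y fx fy exy]; last first.
  by apply: inj; rewrite ?fD // !jf.
apply/setP => y; apply/imsetP/setDP => [[x fx ->]|[]].
  split; first by rewrite -sJ -jf // imset_f // fD.
  apply/negP => /imsetP[z gz]; rewrite -jf // -jg // => /inj eqxz.
  by have := dfg _ fx; rewrite (eqxz (fD _ fx) (gD _ gz)) gz.
rewrite -sJ => /imsetP[x Dx ->] /imsetP ngy.
have fx : x \in supp f.
  rewrite -sDf inE Dx andbT; apply/negP => gx.
  by apply: ngy; exists x; rewrite ?jg.
by exists x; rewrite ?jf.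
Qed.

End PartialInjections.

(** * The lower bound *)

Fixpoint leaves (S T : Type) (E : expr S T) : nat :=
  match E with
  | EEmpty | EUnit | ELeaf _ _ => 1
  | EUnion E1 E2 | EJoin E1 E2 => leaves E1 + leaves E2
  end.

Section LowerBound.
Variables S T : finType.
Implicit Types (E : expr S T) (A : {set {ffun S -> option T}}).

(** Only an inclusion, since a union with an empty operand can enlarge the syntactic domain; it
    still makes the supports in a join disjoint. *)
Lemma sem_supp E A :
  sem E = Some A -> {in A, forall f, supp f \subset Defs.dom E}.
Proof.
elim: E A => [||s t|E1 IH1 E2 IH2|E1 IH1 E2 IH2] A /=.
- by case=> <- f; rewrite inE.
- by case=> <- f /set1P ->; apply/subsetP => x; rewrite !inE ffunE.
- case=> <- f /set1P ->; apply/subsetP => x; rewrite !inE ffunE.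
  by case: (x =P s); rewrite ?eqxx.
- case: (sem E1) IH1 => [A1|] // /(_ _ erefl) IH1.
  case: (sem E2) IH2 => [A2|] // /(_ _ erefl) IH2.
  have sub1 f : f \in A1 -> supp f \subset Defs.dom E1 :|: Defs.dom E2.
    by move/IH1/subset_trans; apply; apply: subsetUl.
  have sub2 f : f \in A2 -> supp f \subset Defs.dom E1 :|: Defs.dom E2.
    by move/IH2/subset_trans; apply; apply: subsetUr.
  case: eqP => _; first by case=> <-.
  case: eqP => _; first by case=> <-.
  by case: ifP => // _ [<-] f /setUP[/sub1|/sub2].
- case: (sem E1) IH1 => [A1|] // /(_ _ erefl) IH1.
  case: (sem E2) IH2 => [A2|] // /(_ _ erefl) IH2.
  case: ifP => // _ [<-] _ /imset2P[f1 f2 Af1 Af2 ->].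
  by rewrite supp_join setUSS ?IH1 ?IH2.
Qed.

(** The factor [r]! bounds the ways to complete a function on [D] to all [3 * m] points. It varies
    in the induction: descending into a join moves the other operand's points into [r]. *)
Lemma leaves_lower_bound (m r : nat) E A (D : {set S}) (J : {set option T}) :
  sem E = Some A -> {in A, forall f, pinj D J f} ->
  m < #|D| -> #|D| + r = 3 * m -> 2 ^ m * (#|A| * r`!) <= leaves E * (3 * m)`!.
Proof.
have pos E' : 0 < leaves E' by elim: E' => //= *; lia.
(* For every constructor at once, [#|D| <= 2 * m] is settled without descending: then [r >= m] too,
   so [#|D|]! [r]! is at most [(3 * m)]! divided by [2 ^ m]. *)
elim: E r A D J => [||s t|E1 IH1 E2 IH2|E1 IH1 E2 IH2] r A D J semE pA ltmD eqr;
  (have [small|big] := leqP #|D| (2 * m);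
    [apply: leq_trans (leq_pmull _ (pos _)); rewrite -eqr;
     apply: leq_trans (@leq_exp2_fact_mul m _ r (ltnW ltmD) _); last (by lia);
     by rewrite leq_mul // leq_mul // (card_pinj_leq pA) |]).
- by case: semE => <-; rewrite cards0 muln0.
- case: semE pA => <- /(_ (pfun_empty S T)).
  rewrite inE eqxx => /(_ isT) [sD _ _]; move: ltmD; rewrite -sD.
  suff -> : supp (pfun_empty S T) = set0 by rewrite cards0.
  by apply/setP => x; rewrite !inE ffunE.
- case: semE pA => <- pA.
  have [] := pA (pfun_single s t); first by rewrite inE.
  (* [m < #|D| <= 1] would force [m = 0], contradicting [#|D| + r = 3 * m]. *)
  move=> sD _ _; suff : #|D| <= 1 by lia.
  rewrite -sD -(cards1 s); apply/subset_leq_card/subsetP => x.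
  by rewrite !inE ffunE; case: (x =P s).
(* Both sides are additive over a union, and each operand keeps [D], [J] and [r] because its
   semantics lies inside [A]. *)
- have split A1 A2 (Fa := (3 * m)`!) :
      2 ^ m * (#|A1| * r`!) <= leaves E1 * Fa ->
      2 ^ m * (#|A2| * r`!) <= leaves E2 * Fa -> #|A| <= #|A1| + #|A2| ->
      2 ^ m * (#|A| * r`!) <= (leaves E1 + leaves E2) * Fa.
    move=> le1 le2 leA; rewrite mulnDl.
    apply: leq_trans (leq_add le1 le2).
    by rewrite -mulnDr -mulnDl leq_mul // leq_mul.
  move: semE split => /=.
  case: (sem E1) IH1 => [A1|] // IH1; case: (sem E2) IH2 => [A2|] // IH2.
  have H1 : A1 \subset A -> 2 ^ m * (#|A1| * r`!) <= leaves E1 * (3 * m)`!.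
    by move=> /subsetP s1; apply: (IH1 r _ D J) => // f /s1 /pA.
  have H2 : A2 \subset A -> 2 ^ m * (#|A2| * r`!) <= leaves E2 * (3 * m)`!.
    by move=> /subsetP s2; apply: (IH2 r _ D J) => // f /s2 /pA.
  case: eqP => [E20|_].
    by case=> eA split; apply: (split A1 A2); rewrite ?H1 ?H2 ?E20 ?sub0set ?eA
      ?leq_addr.
  case: eqP => [E10|_].
    by case=> eA split; apply: (split A1 A2); rewrite ?H1 ?H2 ?E10 ?sub0set ?eA
      ?leq_addl.
  case: ifP => // _ [eA] split; apply: (split A1 A2).
  - by rewrite H1 // -eA subsetUl.
  - by rewrite H2 // -eA subsetUr.
  - by rewrite -eA leq_card_setU.
- move: semE => /=.
  case se1: (sem E1) IH1 => [A1|] // IH1; case se2: (sem E2) IH2 => [A2|] // IH2.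
  case: ifP => // /negbFE/eqP dis12 [eA].
  have dis f1 f2 : f1 \in A1 -> f2 \in A2 -> [disjoint supp f1 & supp f2].
    move=> /(sem_supp se1) s1 /(sem_supp se2) s2.
    apply: disjointWl s1 (disjointWr s2 _).
    by rewrite -setI_eq0 dis12.
  (* One sample [f], the join of [f1] and [f2], fixes the domains and images: [f2] those for all of
     [A1], [f1] those for all of [A2]. *)
  have [->|[f Af]] := set_0Vmem A; first by rewrite cards0 muln0.
  have [f1 f2 Af1 Af2 ef] : imset2_spec (@pfun_join S T) (mem A1) (fun=> mem A2) f.
    by apply/imset2P; rewrite eA.
  have p1 : {in A1, forall g,
      pinj (D :\: supp f2) (J :\: f2 @: supp f2) g}.
    move=> g Ag; apply: pinj_joinl; first exact: dis.
    by apply: pA; rewrite -eA imset2_f.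
  have p2 : {in A2, forall g,
      pinj (D :\: supp f1) (J :\: f1 @: supp f1) g}.
    move=> g Ag; apply: pinj_joinl; first by rewrite disjoint_sym dis.
    by rewrite pfun_joinC 1?disjoint_sym ?dis //; apply: pA; rewrite -eA imset2_f.
  have cA : #|A| <= #|A1| * #|A2|.
    by rewrite -eA curry_imset2X -cardsX leq_imset_card.
  have cD : #|D :\: supp f2| + #|D :\: supp f1| = #|D|.
    have [<- _ _] := p1 _ Af1; have [sf2 _ _] := p2 _ Af2.
    rewrite -sf2; have [<- _ _] := pA _ Af.
    by rewrite ef supp_join; apply/esym/eqP; rewrite leq_card_setU dis.
  have := card_pinj_leq p1; have := card_pinj_leq p2.
  move: cD IH1 IH2 p1 p2.
  set D1 := D :\: supp f2; set D2 := D :\: supp f1.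
  move=> cD IH1 IH2 p1 p2 le2 le1.
  (* As [#|D| > 2 * m], some operand has more than [m] points. The other one contributes at most a
     factorial, absorbed into the new [r]. *)
  have [lt1|ge1] := ltnP m #|D1|.
    have := IH1 (#|D2| + r) _ _ _ erefl p1 lt1 ltac:(lia).
    move=> IH; apply: leq_trans (leq_trans IH _); last by rewrite leq_mul ?leq_addr.
    rewrite leq_mul //; apply: (@leq_trans (#|A1| * (#|D2|`! * r`!))).
      by rewrite mulnA leq_mul // (leq_trans cA) // leq_mul.
    by rewrite leq_mul // leq_fact_mul.
  have lt2 : m < #|D2| by lia.
  have := IH2 (#|D1| + r) _ _ _ erefl p2 lt2 ltac:(lia).
  move=> IH; apply: leq_trans (leq_trans IH _); last by rewrite leq_mul ?leq_addl.
  rewrite leq_mul //; apply: (@leq_trans (#|A2| * (#|D1|`! * r`!))).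
    by rewrite mulnA leq_mul // (leq_trans cA) // mulnC leq_mul.
  by rewrite leq_mul // leq_fact_mul.
Qed.

End LowerBound.

Lemma leaves_permutations (m : nat) (E : expr 'I_(3 * m) 'I_(3 * m)) :
  sem E = Some (permutations_set (3 * m)) -> 2 ^ m <= leaves E.
Proof.
case: m E => [|m] E semE.
  (* The case [m = 0] is separate because the general bound needs [m < 3 * m]. *)
  by elim: E {semE} => //= *; lia.
set n := 3 * m.+1 in E semE *.
have pP : {in permutations_set n, forall f,
    pinj [set: 'I_n] [set Some i | i : 'I_n] f}.
  move=> _ /imsetP[p _ ->]; split.
  - by apply/setP => x; rewrite !inE ffunE.
  - apply/setP => y; apply/imsetP/imsetP => -[x _ ->].
      by exists (p x); rewrite ?ffunE.
    by exists ((p^-1)%g x); rewrite ?ffunE ?permKV.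
  - by move=> x y _ _; rewrite !ffunE => -[/perm_inj].
have cP : #|permutations_set n| = n`!.
  rewrite card_imset ?card_Sn // => p q /ffunP epq; apply/permP => x.
  by have := epq x; rewrite !ffunE => -[].
have := @leaves_lower_bound _ _ m.+1 0 _ _ _ _ semE pP.
rewrite cardsT card_ord cP muln1 leq_pmul2r ?fact_gt0 //; apply; rewrite /n; lia.
Qed.

Lemma leaves_leq_size_encode (n : nat) (E : expr 'I_n 'I_n) :
  leaves E <= size (encode_expr E).
Proof. by elim: E => //= E1 IH1 E2 IH2; rewrite size_cat; lia. Qed.

(** * Output length of machines *)

Lemma size_leading_bits (A : finType) (s : seq (symbol A)) :
  size (leading_bits s) <= size s.
Proof. by elim: s => //= -[[b|a]|] s. Qed.

(** Only a left move lengthens the right part, by one cell. The term [size x] covers the input tape,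
    which is also the output tape on a one-tape machine. *)
Lemma size_right_iter_step (M : machine) (x : seq bool) (t : nat) i :
  size (tape_right ((iter t (@step M) (init_config M x)).2 i)) <= size x + t.
Proof.
elim: t => [|t] /=.
  rewrite size_behead; case: eqP => _; rewrite ?size_map //=; lia.
rewrite /step; case: ifP => _; first lia.
case: tm_trans => q act /=.
by case: (_.2 i) => l h r; case: (act i).2 => //=; rewrite ?size_behead; lia.
Qed.

Lemma size_output_leq (M : machine) (x y : seq bool) (t : nat) :
  outputs_within M x t y -> size y <= (size x + t).+1.
Proof.
move=> [_ <-]; apply: leq_trans (size_leading_bits _) _ => /=.
by rewrite ltnS size_right_iter_step.
Qed.

Theorem theorem1 :
  (exists (P : {poly nat}) (M : machine), forall n : nat,
     exists E : expr 'I_n 'I_n,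
       outputs_within M (nseq n true) P.[n]%R (encode_expr E) /\
       sem E = Some (permutations_set n)) ->
  P_eq_sharpP.
Proof.
move=> [P [M gen]].
(* At [m] this polynomial is [P(3m) + 3m + 1], the bound on the output length for the unary input
   [3 * m]. *)
case: (@exp2_not_leq_poly ((P + 'X + 1%:P) \Po (3 *: 'X))%R) => m.
have [E [out semE]] := gen (3 * m).
apply: leq_trans (leaves_permutations semE) _.
apply: leq_trans (leaves_leq_size_encode _) _.
apply: leq_trans (size_output_leq out) _.
by rewrite size_nseq horner_comp hornerZ !hornerD !hornerX hornerC !natrE addn1 ltnS addnC.
Qed.
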